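(* Let $P$ be the standard triadic Cantor distribution on $\mathbb R$. The set $\alpha_2:=\{a(1,21),\,a(22,23,3)\}$ is an optimal set of two-means for $P$, and the corresponding quantization error is $V_2=\frac{821}{28125}$.
   Context: For $j=1,2,3$ let $S_j:\mathbb R\to\mathbb R$, $S_j(x)=\frac15x+\frac25(j-1)$. The standard triadic Cantor distribution $P$ is the unique Borel probability measure on $\mathbb R$ with $P=\frac13\sum_{j=1}^3P\circ S_j^{-1}$. For a word $\sigma=\sigma_1\cdots\sigma_m\in\{1,2,3\}^m$ put $S_\sigma=S_{\sigma_1}\circ\cdots\circ S_{\sigma_m}$ and $J_\sigma=S_\sigma([0,1])$. Let $X$ be a random variable with distribution $P$. For words $\beta,\gamma,\dots,\delta$, $a(\beta,\gamma,\dots,\delta)$ denotes the conditional expectation $E(X\mid X\in J_\beta\cup J_\gamma\cup\cdots\cup J_\delta)$. For a finite nonempty set $\alpha\subset\mathbb R$ the distortion error is $V(P;\alpha)=\int\min_{a\in\alpha}(x-a)^2\,dP(x)$. The $n$th quantization error is $V_n=V_n(P)=\inf\{V(P;\alpha):\alpha\subset\mathbb R,\ 1\leq\mathrm{card}(\alpha)\leq n\}$. An optimal set of $n$-means is a set $\alpha$ with at most $n$ points for which this infimum is attained. *)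

(* Defs.v *)
From HB Require Import structures.
From mathcomp Require Import all_boot all_order all_algebra finmap.
From mathcomp Require Import all_classical all_reals all_analysis.

Set Implicit Arguments.
Unset Strict Implicit.
Unset Printing Implicit Defensive.

Import Order.TTheory GRing.Theory Num.Theory.
Import numFieldNormedType.Exports.

Local Open Scope classical_set_scope.
Local Open Scope ring_scope.

(* Letters are the natural numbers 1, 2, 3; no other letter occurs in the
   words to which the definitions below are applied. *)
Definition cantor_map (R : realType) (j : nat) (x : R) : R :=
  5^-1 * x + 2 / 5 * (j%:R - 1).

(* Borel sets suffice: a measure is not constrained outside them. *)
Definition triadic_cantor (R : realType) (P : probability (measurableTypeR R) R) :=
  forall A : set (measurableTypeR R), measurable A ->
    P A = ((3^-1)%:E * \sum_(1 <= j < 4) P (cantor_map j @^-1` A))%E.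

Definition cantor_word (R : realType) (sigma : seq nat) (x : R) : R :=
  foldr (@cantor_map R) x sigma.

Definition cantor_cell (R : realType) (sigma : seq nat) : set R :=
  cantor_word sigma @` `[0, 1].

Definition has_law (R : realType) d (T : measurableType d) (Q : probability T R)
    (X : {RV Q >-> measurableTypeR R}) (P : probability (measurableTypeR R) R) :=
  forall A : set (measurableTypeR R), measurable A -> distribution Q X A = P A.

(* E(X | X \in A); meaningful when X \in A has positive probability. *)
Definition cond_expectation (R : realType) d (T : measurableType d)
    (Q : probability T R) (X : {RV Q >-> measurableTypeR R}) (A : set R) : R :=
  fine (\int[Q]_(w in X @^-1` A) (X w)%:E) / fine (Q (X @^-1` A)).

Definition cell_mean (R : realType) d (T : measurableType d)
    (Q : probability T R) (X : {RV Q >-> measurableTypeR R})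
    (words : seq (seq nat)) : R :=
  cond_expectation X (\big[setU/set0]_(sigma <- words) cantor_cell sigma).

Definition distortion (R : realType) (P : probability (measurableTypeR R) R)
    (alpha : {fset R}) : \bar R :=
  (\int[P]_x \big[mine/+oo]_(a <- alpha) ((x - a) ^+ 2)%:E)%E.

Definition quantization_error (R : realType)
    (P : probability (measurableTypeR R) R) (n : nat) : \bar R :=
  ereal_inf [set distortion P alpha | alpha in
    [set alpha : {fset R} | (1 <= #|` alpha| <= n)%N]].

Definition optimal_n_means (R : realType)
    (P : probability (measurableTypeR R) R) (n : nat) (alpha : {fset R}) :=
  (1 <= #|` alpha| <= n)%N /\ distortion P alpha = quantization_error P n.

(* Main.v *)
Require Import Defs.
From HB Require Import structures.
From mathcomp Require Import all_boot all_order all_algebra finmap.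
From mathcomp Require Import all_classical all_reals all_analysis.
From mathcomp Require Import measurable_realfun.
From mathcomp Require Import ring lra.

(** Write f(c) = E|X - c|. If a and b have midpoint c and half-distance h, then
    min((x - a)^2, (x - b)^2) = (x - c)^2 + h^2 - 2 h |x - c|, so the distortion
    of {a, b} is Var X + (c - 1/2)^2 + h^2 - 2 h f(c). Since the variance is
    1/9, minimizing over h (at h = f(c)) gives the lower bound
    1/9 + (c - 1/2)^2 - f(c)^2, and optimality amounts to the inequality
    f(c)^2 <= (c - 1/2)^2 + 256/3125 for every real c ([absdev_bound]).

    The function f is within reach for two reasons. Self-similarity of P gives
    f(c) = (f(5c) + f(5c - 2) + f(5c - 4)) / 15 ([absdev_functional_eq]), and
    f(c) = |c - 1/2| outside [0, 1] because P lives on [0, 1]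
    ([cantor_support]) and has mean 1/2; together they determine f at the endpoints of the gaps
    of the Cantor set, and at 1/2. As f is convex, it lies below its chords
    between these points, and on each piece the square of the chord is compared
    with a quadratic polynomial. The comparison is an equality at exactly
    c = 117/250 and its mirror image; the first point lies in the gap between
    J_21 and J_22, where f is affine and hence equal to its chord.

    At c = 117/250 the optimal half-distance is f(c) = 36/125, which gives the
    points 9/50 and 189/250. That these are the two conditional expectations
    follows from a general formula ([cell_meanE]): each cell J_s has mass
    3^-|s| and barycentre S_s(1/2), and cells of incomparable words are
    disjoint. *)

Set Implicit Arguments.
Unset Strict Implicit.
Unset Printing Implicit Defensive.

Import Order.TTheory GRing.Theory Num.Theory.
Import numFieldNormedType.Exports.

Local Open Scope classical_set_scope.
Local Open Scope ring_scope.

(** * Integration against the self-similar measure *)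

Section CantorIntegral.
Context {R : realType}.

Lemma continuous_cantor_map j : continuous (@cantor_map R j).
Proof.
move=> x; apply: cvgD; last exact: cvg_cst.
exact: cvgMr.
Qed.

Lemma measurable_cantor_map j :
  measurable_fun [set: measurableTypeR R]
    (@cantor_map R j : _ -> measurableTypeR R).
Proof. exact: continuous_measurable_fun (@continuous_cantor_map j). Qed.

Context {P : probability (measurableTypeR R) R}.
Hypothesis hP : triadic_cantor P.

(** Integral form of the defining equation of P, which is an equality of measures
    between P and a scaled sum of image measures. *)
Lemma ge0_cantor_integral (D : set (measurableTypeR R))
    (g : measurableTypeR R -> \bar R) :
    measurable D -> measurable_fun D g -> (forall x, D x -> 0 <= g x)%E ->
  (\int[P]_(x in D) g x = (3^-1)%:E *
     \sum_(1 <= j < 4) \int[P]_(x in cantor_map j @^-1` D) g (cantor_map j x))%E.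
Proof.
move=> mD mg g0.
have ge0 : 0 <= 3^-1 :> R by rewrite invr_ge0.
pose S n : {mfun measurableTypeR R >-> measurableTypeR R} :=
  HB.pack (@cantor_map R n.+1 : measurableTypeR R -> measurableTypeR R)
    (isMeasurableFun.Build _ _ _ _ _ (@measurable_cantor_map n.+1)).
pose m n : {measure set (measurableTypeR R) -> \bar R} := distribution P (S n).
transitivity (\int[mscale (NngNum ge0) (msum m 3)]_(x in D) g x)%E.
  apply: eq_measure_integral => A mA _.
  by rewrite [LHS]hP// /mscale/= /msum big_add1 big_mkord.
rewrite ge0_integral_mscale// ge0_integral_measure_sum// big_add1 big_mkord.
congr (_ * _)%E; apply: eq_bigr => i _.
rewrite ge0_integral_pushforward//.
by move=> x /[!inE]; exact: g0.
Qed.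

Let outside (t : R) : set (measurableTypeR R) := ~` `[- t, 1 + t].

Let measurable_outside t : measurable (outside t).
Proof. exact: measurableC. Qed.

(** The three maps contract distances to [0, 1] by a factor 5, so a point sent
    at distance more than t from [0, 1] was at distance more than 5 t. *)
Lemma cantor_outside_le t : (P (outside t) <= P (outside (5 * t)))%E.
Proof.
rewrite [leLHS]hP//.
apply: (@le_trans _ _ ((3^-1)%:E *
    \sum_(1 <= j < 4) P (outside (5 * t)))%E); last first.
  rewrite big_const_nat/= adde0 -[P _]fineK ?fin_num_measure//.
  by rewrite -!EFinD -EFinM lee_fin; lra.
rewrite lee_wpmul2l ?lee_fin ?invr_ge0//.
rewrite big_nat [leRHS]big_nat; apply: lee_sum => j /andP[j1 j3].
apply: le_measure; rewrite ?inE//.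
  by rewrite -[X in measurable X]setTI; exact: measurable_cantor_map.
move=> x; rewrite /outside/=; apply: contra_not.
have {}j1 : 1 <= j%:R :> R by rewrite ler1n.
have {}j3 : j%:R <= 3 :> R by rewrite ler_nat.
rewrite !in_itv/= /cantor_map => /andP[xl xr]; apply/andP; split; lra.
Qed.

(** Iterating [cantor_outside_le], the mass at distance more than t > 0 from
    [0, 1] is at most the mass at distance more than n t for every n; the latter
    tends to 0 because P is finite. *)
Lemma cantor_support : P (~` `[0%R, 1%R]) = 0%E.
Proof.
have le_outside s t : s <= t -> outside t `<=` outside s.
  move=> st x; rewrite /outside/=; apply: contra_not; rewrite !in_itv/= => /andP[xl xr].
  by apply/andP; split; lra.
have P_outside t : 0 < t -> P (outside t) = 0%E.
  move=> t0.
  have iterB n : (P (outside t) <= P (outside (5 ^+ n * t)))%E.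
    elim: n => [|n IHn]; first by rewrite expr0 mul1r.
    by rewrite (le_trans IHn)// exprS -mulrA cantor_outside_le.
  have cvgB : P (outside (n%:R * t)) @[n --> \oo] --> 0%E.
    rewrite -(measure0 P) -(_ : \bigcap_n outside (n%:R * t) = set0).
      apply: nonincreasing_cvg_mu => //.
      - by rewrite (le_lt_trans (probability_le1 _ _))// ltry.
      - exact: bigcapT_measurable.
      - move=> m n mn; apply/subsetPset; apply: le_outside.
        by rewrite ler_wpM2r ?ler_nat// ltW.
    rewrite -subset0 => x /(_ (Num.truncn (`|x| / t)).+1 I); apply.
    have : `|x| < (Num.truncn (`|x| / t)).+1%:R * t.
      by rewrite -ltr_pdivrMr// truncnS_gt.
    rewrite ltr_norml => /andP[xl xr].
    by rewrite /outside/= in_itv/=; apply/andP; split; lra.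
  apply/eqP; rewrite eq_le measure_ge0 andbT.
  apply: cvge_ge cvgB; near=> n.
  apply: le_trans (iterB n) _; apply: le_measure; rewrite ?inE//.
  apply: le_outside; rewrite ler_wpM2r ?(ltW t0)// -natrX ler_nat.
  by rewrite ltnW// ltn_expl.
apply: measure_negligible; first exact: measurableC.
apply: (@negligibleS _ _ _ _ (\bigcup_k outside (k.+1%:R^-1))); last first.
  by apply: negligible_bigcup => k; apply/negligibleP => //; apply: P_outside.
move=> x /= x01.
(* For x outside [0, 1], this is its distance to [0, 1]. *)
pose e := Num.max (- x) (x - 1).
have e0 : 0 < e.
  rewrite ltNge; apply: contra_notN x01.
  by rewrite ge_max in_itv/= => /andP[? ?]; apply/andP; split; lra.
exists (Num.truncn e^-1) => //=.
have : (Num.truncn e^-1).+1%:R^-1 < e.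
  by rewrite invf_plt ?posrE// truncnS_gt.
rewrite /outside/= in_itv/= lt_max; move: (_^-1) => s.
move=> /orP[?|?] /andP[? ?]; lra.
Unshelve. all: by end_near. Qed.

Lemma cantor_integrable (g : R -> R) : continuous g ->
  P.-integrable [set: measurableTypeR R] (EFin \o g).
Proof.
move=> cg.
have mg := continuous_measurable_fun cg.
apply/(@negligible_integrable _ _ _ P _ (~` `[0, 1])) => //.
- exact: measurableC.
- exact/measurable_EFinP.
- exact: cantor_support.
rewrite setTD setCK; apply: measurable_bounded_integrable => //.
- by rewrite (le_lt_trans (probability_le1 _ _))// ltry.
- exact: measurable_funTS.
have /compact_bounded[M [_ leM]] :=
  continuous_compact (continuous_subspaceT cg) (@segment_compact R 0 1).
by exists M; split; rewrite ?num_real // => t Mt x x01; apply: leM => //; exists x.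
Qed.

(** By [cantor_support], integrands need only be compared on [0, 1]. *)
Lemma le_cantor_Rintegral (g h : R -> R) : continuous g -> continuous h ->
    (forall x, 0 <= x <= 1 -> g x <= h x) ->
  \int[P]_x g x <= \int[P]_x h x.
Proof.
move=> cg ch gh.
have restr (k : R -> R) : continuous k ->
    \int[P]_x k x = \int[P]_(x in `[0, 1]) k x.
  move=> ck; rewrite /Rintegral.
  rewrite (@negligible_integral _ _ _ P _ (~` `[0, 1])) ?setTD ?setCK//.
  - exact: measurableC.
  - exact: cantor_integrable.
  - exact: cantor_support.
rewrite !restr//; apply: le_Rintegral => //.
- by apply: (integrableS measurableT) => //; exact: cantor_integrable.
- by apply: (integrableS measurableT) => //; exact: cantor_integrable.
Qed.

Lemma eq_cantor_Rintegral (g h : R -> R) : continuous g -> continuous h ->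
    (forall x, 0 <= x <= 1 -> g x = h x) ->
  \int[P]_x g x = \int[P]_x h x.
Proof.
move=> cg ch gh; apply/eqP; rewrite eq_le.
by apply/andP; split; apply: le_cantor_Rintegral => // x /gh ->.
Qed.

Lemma cantor_Rintegral (g : R -> R) : continuous g -> (forall x, 0 <= g x) ->
  \int[P]_x g x = 3^-1 * \sum_(1 <= j < 4) \int[P]_x g (cantor_map j x).
Proof.
move=> cg g0.
have cgS j : continuous (g \o @cantor_map R j).
  by move=> x; apply: continuous_comp; [exact: continuous_cantor_map|exact: cg].
apply: EFin_inj; rewrite EFinM -sumEFin /Rintegral fineK; last first.
  by apply: integrable_fin_num => //; exact: cantor_integrable.
rewrite ge0_cantor_integral//; last 2 first.
- by apply/measurable_EFinP; exact: continuous_measurable_fun.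
- by move=> x _; rewrite lee_fin.
congr (_ * _)%E; apply: eq_bigr => j _; rewrite preimage_setT fineK//.
by apply: integrable_fin_num => //; exact: (cantor_integrable (cgS j)).
Qed.

(** * Moments and mean absolute deviation *)

Local Notation m1 := (\int[P]_x x).
Local Notation m2 := (\int[P]_x x ^+ 2).
Local Notation absdev c := (\int[P]_x `|x - c|).

Lemma continuous_absdev (c : R) : continuous (fun x : R => `|x - c|).
Proof.
move=> x; apply: cvg_norm; apply: cvgB; [exact: cvg_id|exact: cvg_cst].
Qed.

Lemma continuous_comb (p q r w c : R) :
  continuous (fun x : R => p * x ^+ 2 + q * x + r + w * `|x - c|).
Proof.
move=> x; apply: cvgD; last by apply: cvgMr; exact: continuous_absdev.
apply: cvgD; last exact: cvg_cst.
by apply: cvgD; apply: cvgMr; [exact: exprn_continuous|exact: cvg_id].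
Qed.

#[local] Hint Resolve continuous_absdev continuous_comb : core.

Lemma cantor_Rintegral_linear (a b : R) (g h : R -> R) :
    continuous g -> continuous h ->
  \int[P]_x (a * g x + b * h x) = a * \int[P]_x g x + b * \int[P]_x h x.
Proof.
move=> cg ch.
have ig := cantor_integrable cg; have ih := cantor_integrable ch.
rewrite (RintegralD measurableT) ?RintegralZl//.
- exact: (integrableZl measurableT a ig).
- exact: (integrableZl measurableT b ih).
Qed.

(** Every integral evaluated below has an integrand of this shape; terms with a
    zero coefficient are inserted to fit it. *)
Lemma cantor_Rintegral_comb (p q r w c : R) :
  \int[P]_x (p * x ^+ 2 + q * x + r + w * `|x - c|) =
  p * m2 + q * m1 + r + w * absdev c.
Proof.
have c2 : continuous (fun x : R => x ^+ 2) by exact: exprn_continuous.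
have c1 : continuous (fun x : R => x) by move=> x; exact: cvg_id.
have c0 : continuous (fun _ : R => 1 : R) by move=> x; exact: cvg_cst.
have c01 (a b : R) : continuous (fun x : R => a * x + b * 1).
  by move=> x; apply: cvgD; apply: cvgMr; [exact: c1|exact: c0].
have c012 : continuous (fun x : R => p * x ^+ 2 + 1 * (q * x + r * 1)).
  by move=> x; apply: cvgD; apply: cvgMr; [exact: c2|exact: c01].
transitivity (\int[P]_x (1 * (p * x ^+ 2 + 1 * (q * x + r * 1)) + w * `|x - c|)).
  by apply: eq_Rintegral => x _; ring.
rewrite !cantor_Rintegral_linear// Rintegral_cst//= probability_setT/=; ring.
Qed.

(** Self-similarity, with |S_j x - c| = |x - (5 c - 2 (j - 1))| / 5. *)
Lemma absdev_functional_eq (c : R) :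
  absdev c = 15^-1 * (absdev (5 * c) + absdev (5 * c - 2) + absdev (5 * c - 4)).
Proof.
rewrite cantor_Rintegral//.
have part j : \int[P]_x `|cantor_map j x - c| =
    5^-1 * absdev (5 * c - 2 * (j%:R - 1)).
  transitivity (\int[P]_x (0 * x ^+ 2 + 0 * x + 0 +
      5^-1 * `|x - (5 * c - 2 * (j%:R - 1))|)).
    apply: eq_Rintegral => x _; rewrite !mul0r !add0r.
    have -> : cantor_map j x - c = 5^-1 * (x - (5 * c - 2 * (j%:R - 1))).
      by rewrite /cantor_map; field.
    by rewrite normrM ger0_norm ?invr_ge0.
  by rewrite cantor_Rintegral_comb; ring.
rewrite /index_iota/= !big_cons big_nil !part.
rewrite subrr mulr0 subr0 (_ : 2 * (2 - 1) = 2 :> R); last by ring.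
rewrite (_ : 2 * (3 - 1) = 4 :> R); last by ring.
by rewrite addr0; field.
Qed.

Let absdev_le0 (c : R) : c <= 0 -> absdev c = m1 - c.
Proof.
move=> c0; transitivity (\int[P]_x (0 * x ^+ 2 + 1 * x + (- c) + 0 * `|x - c|)).
  apply: eq_cantor_Rintegral => // x /andP[x0 x1].
  by rewrite ger0_norm ?subr_ge0; [ring|lra].
by rewrite cantor_Rintegral_comb; ring.
Qed.

Let absdev_ge1 (c : R) : 1 <= c -> absdev c = c - m1.
Proof.
move=> c1.
transitivity (\int[P]_x (0 * x ^+ 2 + (- 1) * x + c + 0 * `|x - c|)).
  apply: eq_cantor_Rintegral => // x /andP[x0 x1].
  by rewrite ler0_norm ?subr_le0; [ring|lra].
by rewrite cantor_Rintegral_comb; ring.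
Qed.

(** At c = 0 all three arguments on the right of the functional equation are
    nonpositive, where the deviation is [m1 - c]; the equation becomes linear in
    the mean. *)
Lemma cantor_mean : m1 = 2^-1.
Proof.
have := absdev_functional_eq 0.
by rewrite !absdev_le0; lra.
Qed.

Lemma cantor_second_moment : m2 = 13 / 36.
Proof.
have : m2 = 3^-1 * \sum_(1 <= j < 4) \int[P]_x (@cantor_map R j x) ^+ 2.
  by rewrite cantor_Rintegral//; [exact: exprn_continuous|move=> x; exact: sqr_ge0].
have part j : \int[P]_x (@cantor_map R j x) ^+ 2 =
    25^-1 * m2 + 4 / 25 * (j%:R - 1) * m1 + 4 / 25 * (j%:R - 1) ^+ 2.
  transitivity (\int[P]_x (25^-1 * x ^+ 2 + 4 / 25 * (j%:R - 1) * x +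
      4 / 25 * (j%:R - 1) ^+ 2 + 0 * `|x - 0|)).
    by apply: eq_Rintegral => x _; rewrite /cantor_map; field.
  by rewrite cantor_Rintegral_comb mul0r addr0.
rewrite /index_iota/= !big_cons big_nil !part cantor_mean; lra.
Qed.

Lemma absdev_left (c : R) : c <= 0 -> absdev c = 2^-1 - c.
Proof. by move=> c0; rewrite absdev_le0// cantor_mean. Qed.

Lemma absdev_right (c : R) : 1 <= c -> absdev c = c - 2^-1.
Proof. by move=> c1; rewrite absdev_ge1// cantor_mean. Qed.

(** For such c, two of the three arguments in the functional equation leave
    the open interval from 0 to 1 on opposite sides, and together contribute 4. *)
Lemma absdev_middle (c : R) : 1 / 5 <= c <= 4 / 5 ->
  absdev c = (absdev (5 * c - 2) + 4) / 15.
Proof.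
move=> /andP[cl cr]; rewrite [LHS]absdev_functional_eq.
by rewrite absdev_right ?(@absdev_left (5 * c - 4)); lra.
Qed.

Let absdev_middle_val (c c' v : R) : 1 / 5 <= c <= 4 / 5 -> c' = 5 * c - 2 ->
  absdev c' = v -> absdev c = (v + 4) / 15.
Proof. by move=> hc -> <-; exact: absdev_middle. Qed.

(** The point 1/2 is fixed by [c |-> 5 c - 2]. *)
Lemma absdev_half : absdev (1 / 2) = 2 / 7.
Proof. by have := @absdev_middle (1 / 2); rewrite (_ : 5 * _ - 2 = 1 / 2); lra. Qed.

(** The value at the midpoint of 9/50 and 189/250, reached through
    117/250 |-> 17/50 |-> -3/10. *)
Lemma absdev_midpoint : absdev (117 / 250) = 36 / 125.
Proof.
have absdev_17_50 : absdev (17 / 50) = 8 / 25.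
  by rewrite absdev_middle ?absdev_left; lra.
by rewrite (@absdev_middle_val _ _ _ _ _ absdev_17_50); lra.
Qed.

(** Division-free form of the convexity of the deviation. *)
Lemma absdev_convex (a b c : R) : a <= c <= b ->
  (b - a) * absdev c <= (b - c) * absdev a + (c - a) * absdev b.
Proof.
move=> /andP[ac cb]; rewrite -cantor_Rintegral_linear//.
rewrite -[leLHS]add0r -[X in X + _](mul0r (absdev c)).
rewrite -cantor_Rintegral_linear//.
apply: le_cantor_Rintegral.
- by move=> x; apply: cvgD; apply: cvgMr; exact: continuous_absdev.
- by move=> x; apply: cvgD; apply: cvgMr; exact: continuous_absdev.
move=> x _; rewrite mul0r add0r.
have ba : 0 <= b - a by lra.
rewrite -(ger0_norm ba) -normrM.
rewrite (_ : (b - a) * (x - c) = (b - c) * (x - a) + (c - a) * (x - b)); last by ring.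
apply: le_trans (ler_normD _ _) _.
by rewrite !normrM (@ger0_norm _ (b - c)) ?(@ger0_norm _ (c - a)) ?subr_ge0.
Qed.

Let sqr_bound (y l r : R) : 0 <= y -> y <= l -> l ^+ 2 <= r -> y ^+ 2 <= r.
Proof. by move=> y0 yl; apply: le_trans; rewrite lerXn2r// nnegrE; lra. Qed.

Let absdev_0 : absdev 0 = 1 / 2.
Proof. by rewrite absdev_left; lra. Qed.

Let absdev_1 : absdev 1 = 1 / 2.
Proof. by rewrite absdev_right; lra. Qed.

Let absdev_1_5 : absdev (1 / 5) = 11 / 30.
Proof. by rewrite absdev_middle ?absdev_left; lra. Qed.

Let absdev_4_5 : absdev (4 / 5) = 11 / 30.
Proof. by rewrite absdev_middle ?absdev_right; lra. Qed.

Let absdev_2_5 : absdev (2 / 5) = 3 / 10.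
Proof. by rewrite absdev_middle ?absdev_left; lra. Qed.

Let absdev_3_5 : absdev (3 / 5) = 3 / 10.
Proof. by rewrite absdev_middle ?absdev_right; lra. Qed.

Let absdev_11_25 : absdev (11 / 25) = 131 / 450.
Proof. by rewrite (@absdev_middle_val _ _ _ _ _ absdev_1_5); lra. Qed.

Let absdev_14_25 : absdev (14 / 25) = 131 / 450.
Proof. by rewrite (@absdev_middle_val _ _ _ _ _ absdev_4_5); lra. Qed.

Let absdev_12_25 : absdev (12 / 25) = 43 / 150.
Proof. by rewrite (@absdev_middle_val _ _ _ _ _ absdev_2_5); lra. Qed.

Let absdev_13_25 : absdev (13 / 25) = 43 / 150.
Proof. by rewrite (@absdev_middle_val _ _ _ _ _ absdev_3_5); lra. Qed.

(** On each subinterval of [0, 1], the affine function given to [sqr_bound] is the chord of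
    the deviation. The bound minus the square of the chord is a quadratic
    polynomial with positive leading coefficient; the square supplied to [lra]
    is centred at its vertex. The bound is attained on the two intervals
    from 11/25 to 12/25 and from 13/25 to 14/25, which are gaps of the
    Cantor set. *)
Lemma absdev_bound (c : R) : absdev c ^+ 2 <= (c - 1 / 2) ^+ 2 + 256 / 3125.
Proof.
have f0 : 0 <= absdev c by apply: Rintegral_ge0.
have conv a b := @absdev_convex a b c.
have [c0|c0] := lerP c 0; first by rewrite absdev_left//; lra.
have [c1|c1] := lerP 1 c; first by rewrite absdev_right//; lra.
have [h1|h1] := lerP c (1 / 5).
  apply: (@sqr_bound _ (1 / 2 - 2 / 3 * c)) => //; last first.
    by have := sqr_ge0 (c - 3 / 10); lra.
  by have := conv 0 (1 / 5); rewrite absdev_0 absdev_1_5; lra.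
have [h2|h2] := lerP c (2 / 5).
  apply: (@sqr_bound _ (13 / 30 - 1 / 3 * c)) => //; last first.
    by have := sqr_ge0 (c - 2 / 5); lra.
  by have := conv (1 / 5) (2 / 5); rewrite absdev_1_5 absdev_2_5; lra.
have [h3|h3] := lerP c (11 / 25).
  apply: (@sqr_bound _ (3 / 10 - 2 / 9 * (c - 2 / 5))) => //; last first.
    by have := sqr_ge0 (c - 67 / 154); lra.
  by have := conv (2 / 5) (11 / 25); rewrite absdev_2_5 absdev_11_25; lra.
have [h4|h4] := lerP c (12 / 25).
  apply: (@sqr_bound _ (36 / 125 - (c - 117 / 250) / 9)) => //; last first.
    by have := sqr_ge0 (c - 117 / 250); lra.
  by have := conv (11 / 25) (12 / 25); rewrite absdev_11_25 absdev_12_25; lra.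
have [h5|h5] := lerP c (1 / 2).
  apply: (@sqr_bound _ (2 / 7 - 1 / 21 * (c - 1 / 2))) => //; last first.
    by have := sqr_ge0 (c - 107 / 220); lra.
  by have := conv (12 / 25) (1 / 2); rewrite absdev_12_25 absdev_half; lra.
have [h6|h6] := lerP c (13 / 25).
  apply: (@sqr_bound _ (2 / 7 + 1 / 21 * (c - 1 / 2))) => //; last first.
    by have := sqr_ge0 (c - 113 / 220); lra.
  by have := conv (1 / 2) (13 / 25); rewrite absdev_13_25 absdev_half; lra.
have [h7|h7] := lerP c (14 / 25).
  apply: (@sqr_bound _ (36 / 125 + (c - 133 / 250) / 9)) => //; last first.
    by have := sqr_ge0 (c - 133 / 250); lra.
  by have := conv (13 / 25) (14 / 25); rewrite absdev_13_25 absdev_14_25; lra.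
have [h8|h8] := lerP c (3 / 5).
  apply: (@sqr_bound _ (3 / 10 + 2 / 9 * (c - 3 / 5))) => //; last first.
    by have := sqr_ge0 (c - 87 / 154); lra.
  by have := conv (14 / 25) (3 / 5); rewrite absdev_3_5 absdev_14_25; lra.
have [h9|h9] := lerP c (4 / 5).
  apply: (@sqr_bound _ (1 / 10 + 1 / 3 * c)) => //; last first.
    by have := sqr_ge0 (c - 3 / 5); lra.
  by have := conv (3 / 5) (4 / 5); rewrite absdev_3_5 absdev_4_5; lra.
apply: (@sqr_bound _ (- 1 / 6 + 2 / 3 * c)) => //; last first.
    by have := sqr_ge0 (c - 7 / 10); lra.
by have := conv (4 / 5) 1; rewrite absdev_4_5 absdev_1; lra.
Qed.

End CantorIntegral.

(** * Cells of the construction *)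

Section CantorCells.
Context {R : realType}.

Lemma cantor_word_affine s (x : R) :
  cantor_word s x = 5^-1 ^+ size s * x + cantor_word s 0.
Proof.
elim: s => [|j s IHs] /=; first by rewrite expr0 mul1r addr0.
by rewrite [in LHS]/cantor_map IHs exprS /cantor_map; ring.
Qed.

Lemma continuous_cantor_word s : continuous (@cantor_word R s).
Proof.
elim: s => [|j s IHs] x; first exact: cvg_id.
apply: (@continuous_comp _ _ _ (cantor_word s)).
  exact: IHs.
exact: continuous_cantor_map.
Qed.

Lemma measurable_cantor_cell s :
  measurable (cantor_cell s : set (measurableTypeR R)).
Proof.
apply: compact_measurable; apply: continuous_compact; last exact: segment_compact.
exact: continuous_subspaceT (@continuous_cantor_word s).
Qed.

Definition ternary (s : seq nat) := all (fun j => (0 < j < 4)%N) s.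

Lemma cantor_cell_cons j s :
  cantor_cell (j :: s) = [set cantor_map j x | x in cantor_cell s] :> set R.
Proof. by rewrite /cantor_cell -image_comp. Qed.

Lemma cantor_cell_sub s : ternary s -> cantor_cell s `<=` `[0, 1 : R].
Proof.
elim: s => [_|j s IHs /=/andP[/andP[j1 j3] /IHs sub]].
  by rewrite /cantor_cell image_id.
rewrite cantor_cell_cons => _ [x /sub + <-].
have {}j1 : 1 <= j%:R :> R by rewrite ler1n.
have {}j3 : j%:R <= 3 :> R by rewrite ler_nat.
rewrite /= !in_itv/= /cantor_map => /andP[xl xr]; apply/andP; split; lra.
Qed.

(** The images of [0, 1] under the three maps are pairwise disjoint, and each map
    is injective. *)
Lemma cantor_map_inj (i j : nat) (x y : R) : x \in `[0, 1] -> y \in `[0, 1] ->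
  cantor_map i x = cantor_map j y -> i = j /\ x = y.
Proof.
rewrite !in_itv/= /cantor_map => /andP[x0 x1] /andP[y0 y1] eqxy.
have [ij|ij|ij] := ltngtP i j; last by split=> //; move: eqxy; rewrite ij; lra.
- by have : i%:R + 1 <= j%:R :> R; [rewrite natr1 ler_nat|lra].
- by have : j%:R + 1 <= i%:R :> R; [rewrite natr1 ler_nat|lra].
Qed.

Lemma preimage_cantor_cell i j s : ternary s ->
  cantor_map i @^-1` cantor_cell (j :: s) `&` `[0, 1] =
  if i == j then cantor_cell s else set0 :> set R.
Proof.
move=> ts; rewrite cantor_cell_cons; apply/seteqP; split=> x /=.
  move=> [[y sy ijxy] x01].
  have [<- <-] := cantor_map_inj (cantor_cell_sub ts sy) x01 ijxy.
  by rewrite eqxx.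
case: eqP => [->|//] sx; split; first by exists x.
exact: (cantor_cell_sub ts).
Qed.

(** A common point determines the letters of both words one by one, until the
    shorter one ends. *)
Lemma cantor_cell_prefix s t (x : R) : ternary s -> ternary t ->
  cantor_cell s x -> cantor_cell t x -> prefix s t || prefix t s.
Proof.
elim: s t x => [|i s IHs] [|j t] x //= /andP[_ ts] /andP[_ tt].
rewrite !cantor_cell_cons => -[y sy <-] [z tz ijzy].
have [eji eyz] :=
  cantor_map_inj (cantor_cell_sub tt tz) (cantor_cell_sub ts sy) ijzy.
by move: tz; rewrite eji eyz eqxx => tz; exact: (IHs t y).
Qed.

Context {P : probability (measurableTypeR R) R}.
Hypothesis hP : triadic_cantor P.

(** Each letter of the word costs one use of self-similarity: of the three pulled
    back domains, only the one of the first letter meets [0, 1], where it is the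
    cell of the remaining word. *)
Lemma ge0_cantor_cell_integral s (g : measurableTypeR R -> \bar R) :
    ternary s -> measurable_fun setT g -> (forall x, 0 <= g x)%E ->
  (\int[P]_(x in cantor_cell s) g x =
   (3^-1 ^+ size s)%:E * \int[P]_x g (cantor_word s x))%E.
Proof.
have restr (h : measurableTypeR R -> \bar R) D : measurable D ->
    measurable_fun setT h -> (forall x, 0 <= h x)%E ->
    (\int[P]_(x in D) h x = \int[P]_(x in D `&` `[0%R, 1%R]) h x)%E.
  move=> mD mh h0.
  rewrite (@ge0_negligible_integral _ _ _ P D (~` `[0, 1])) ?setDE ?setCK//.
  - exact: measurableC.
  - exact: measurable_funTS.
  - exact: cantor_support hP.
have mS j : measurable_fun setT (@cantor_map R j : _ -> measurableTypeR R).
  exact: measurable_cantor_map.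
elim: s g => [|j s IHs] g /=.
  move=> _ mg g0; rewrite /cantor_cell image_id expr0 mul1e.
  by rewrite [RHS]restr// setTI.
move=> /andP[j123 ts] mg g0.
rewrite (ge0_cantor_integral hP)//; last 2 first.
- exact: measurable_cantor_cell.
- exact: measurable_funTS.
rewrite exprS EFinM -muleA; congr (_ * _)%E.
have mgS i : measurable_fun setT (g \o @cantor_map R i).
  exact: measurableT_comp.
have mpre i : measurable (@cantor_map R i @^-1` cantor_cell (j :: s)).
  rewrite -[X in measurable X]setTI; apply: mS => //.
  exact: measurable_cantor_cell.
have part i : (\int[P]_(x in cantor_map i @^-1` cantor_cell (j :: s))
    g (cantor_map i x) =
    \int[P]_(x in if i == j then cantor_cell s else set0) g (cantor_map i x))%E.
  rewrite -preimage_cantor_cell//.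
  exact: (restr _ _ (mpre i) (mgS i) (fun=> g0 _)).
under eq_bigr do rewrite part.
rewrite (bigD1_seq j) ?mem_index_iota ?iota_uniq//= eqxx.
rewrite big1 => [|i /negbTE ->]; last by rewrite integral_set0.
by rewrite adde0; exact: (IHs (g \o @cantor_map R j) ts (mgS j) (fun=> g0 _)).
Qed.

End CantorCells.

(** * Conditional expectations over unions of cells *)

Section CellMean.
Context {R : realType} {P : probability (measurableTypeR R) R}.
Hypothesis hP : triadic_cantor P.

Definition prefix_free (ws : seq (seq nat)) :=
  [&& uniq ws, all ternary ws &
    all2rel (fun s t => prefix s t ==> (s == t)) ws].

Lemma ge0_cantor_cells_integral ws (g : measurableTypeR R -> \bar R) :
    prefix_free ws -> measurable_fun setT g -> (forall x, 0 <= g x)%E ->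
  (\int[P]_(x in \big[setU/set0]_(s <- ws) cantor_cell s) g x =
   \sum_(s <- ws) (3^-1 ^+ size s)%:E * \int[P]_x g (cantor_word s x))%E.
Proof.
move=> /and3P[uws /allP tws /allrelP pws] mg g0.
rewrite (@ge0_integral_bigsetU _ _ _ P _ (@cantor_cell R) g ws)//.
- rewrite big_seq [RHS]big_seq; apply: eq_bigr => s sws.
  by rewrite (ge0_cantor_cell_integral hP)//; exact: tws.
- by move=> s; exact: measurable_cantor_cell.
- move=> s t sws tws' [x [sx tx]].
  have /orP[] := cantor_cell_prefix (tws _ sws) (tws _ tws') sx tx => st.
    exact/eqP/(implyP (pws _ _ sws tws')).
  exact/esym/eqP/(implyP (pws _ _ tws' sws)).
- exact: measurable_funTS.
Qed.

Lemma cantor_cells_mass ws : prefix_free ws ->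
  P (\big[setU/set0]_(s <- ws) cantor_cell s) =
  (\sum_(s <- ws) 3^-1 ^+ size s)%:E.
Proof.
move=> pws; rewrite -[LHS]mul1e -integral_cst; last first.
  by apply: bigsetU_measurable => s _; exact: measurable_cantor_cell.
rewrite (@ge0_cantor_cells_integral _ (cst 1%E))//= -sumEFin.
by apply: eq_bigr => s _; rewrite integral_cst//= probability_setT !mule1.
Qed.

(** The absolute value keeps the integrand nonnegative on the whole line; it is
    harmless because the cells lie in [0, 1]. *)
Lemma cantor_cells_moment ws : prefix_free ws ->
  (\int[P]_(x in \big[setU/set0]_(s <- ws) cantor_cell s) `|x|%:E =
   (\sum_(s <- ws) 3^-1 ^+ size s * cantor_word s 2^-1)%:E)%E.
Proof.
move=> pws; have /and3P[_ /allP tws _] := pws.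
have cn : continuous (fun x : R => `|x|) by exact: norm_continuous.
rewrite (@ge0_cantor_cells_integral _ (fun x : R => `|x|%:E))//; last first.
  by apply/measurable_EFinP; exact: continuous_measurable_fun.
rewrite -sumEFin big_seq [RHS]big_seq; apply: eq_bigr => s /tws ts.
rewrite EFinM; congr (_ * _)%E.
have cw : continuous (fun x : R => `|cantor_word s x|).
  move=> x; apply: (@continuous_comp _ _ _ (cantor_word s)).
    exact: continuous_cantor_word.
  exact: norm_continuous.
rewrite -[LHS]fineK; last first.
  by apply: integrable_fin_num => //; exact: (cantor_integrable hP cw).
congr EFin; rewrite -/(Rintegral P setT (fun x : R => `|cantor_word s x|)).
transitivity (\int[P]_x (0 * x ^+ 2 + 5^-1 ^+ size s * x + cantor_word s 0
    + 0 * `|x - 0|)).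
  apply: (eq_cantor_Rintegral hP) => // [|x x01].
    by apply: continuous_comb.
  rewrite ger0_norm; first by rewrite cantor_word_affine; ring.
  have : cantor_cell s (cantor_word s x) by exists x => //=; rewrite in_itv.
  by move/(cantor_cell_sub ts); rewrite /= in_itv/= => /andP[].
rewrite (cantor_Rintegral_comb hP) (cantor_mean hP) [RHS]cantor_word_affine.
by ring.
Qed.

(** The barycentre of a union of disjoint cells: the cell of s has weight
    3^-|s| and, S_s being affine and 1/2 the mean of P, barycentre S_s(1/2). *)
Lemma cell_meanE d (T : measurableType d) (Q : probability T R)
    (X : {RV Q >-> measurableTypeR R}) ws : has_law X P -> prefix_free ws ->
  cell_mean X ws = (\sum_(s <- ws) 3^-1 ^+ size s * cantor_word s 2^-1) /
                   \sum_(s <- ws) 3^-1 ^+ size s.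
Proof.
move=> hX pws; have /and3P[_ /allP tws _] := pws.
rewrite /cell_mean.
pose A : set (measurableTypeR R) :=
  \big[setU/set0]_(s <- ws) cantor_cell s.
rewrite -/A; have mA : measurable A.
  by apply: bigsetU_measurable => s _; exact: measurable_cantor_cell.
have A0 x : A x -> 0 <= x.
  rewrite /A -bigcup_seq => -[s /= /tws ts /(cantor_cell_sub ts)].
  by rewrite /= in_itv/= => /andP[].
have mn : measurable_fun setT (fun x : measurableTypeR R => `|x|%:E).
  by apply/measurable_EFinP; exact: continuous_measurable_fun (@norm_continuous _ _).
have QA : Q (X @^-1` A) = (\sum_(s <- ws) 3^-1 ^+ size s)%:E.
  by rewrite -cantor_cells_mass//; exact: hX.
rewrite /cond_expectation QA.
congr (_ / _).
transitivity (fine (\int[P]_(x in A) `|x|%:E)); last first.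
  by rewrite cantor_cells_moment.
congr fine; rewrite -(@eq_measure_integral _ _ _ A P (distribution Q X)); last first.
  by move=> B mB _; exact: hX.
rewrite ge0_integral_pushforward//; last exact: measurable_funTS.
by apply: eq_integral => w; rewrite inE/= => /A0 Xw0; rewrite ger0_norm.
Qed.

End CellMean.

(** * Distortion of a pair of points *)

Section TwoMeans.
Context {R : realType} {P : probability (measurableTypeR R) R}.
Hypothesis hP : triadic_cantor P.

Local Notation absdev c := (\int[P]_x `|x - c|).

Lemma le_big_mine (I : eqType) (s : seq I) (F : I -> \bar R) (z : \bar R) :
  (z <= \big[mine/+oo]_(i <- s) F i)%E = all (fun i => z <= F i)%E s.
Proof.
elim: s => [|i s IHs]; first by rewrite big_nil leey.
by rewrite big_cons le_min IHs.
Qed.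

(** The minimum of two numbers is their half-sum minus half their distance, and
    the difference of the two squares is affine in x with root the midpoint. *)
Lemma min_sqr_dist (a b x : R) :
  Num.min ((x - a) ^+ 2) ((x - b) ^+ 2) =
  1 * x ^+ 2 + (- (a + b)) * x + (a ^+ 2 + b ^+ 2) / 2
    + (- `|b - a|) * `|x - (a + b) / 2|.
Proof.
rewrite (mulNr `|b - a|) -normrM; set t := (b - a) * _.
have et : (x - a) ^+ 2 - (x - b) ^+ 2 = 2 * t by rewrite /t; field.
have [ab|ba] := leP ((x - a) ^+ 2) ((x - b) ^+ 2).
- rewrite ler0_norm; last by lra.
  by rewrite /t; field.
- rewrite ger0_norm; last by lra.
  by rewrite /t; field.
Qed.

Lemma distortion_pair (a b : R) :
  distortion P [fset a; b]%fset =
  (1 / 9 + ((a + b) / 2 - 1 / 2) ^+ 2 + ((b - a) / 2) ^+ 2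
     - `|b - a| * absdev ((a + b) / 2))%:E.
Proof.
pose q (x : R) := 1 * x ^+ 2 + (- (a + b)) * x + (a ^+ 2 + b ^+ 2) / 2
    + (- `|b - a|) * `|x - (a + b) / 2|.
have minE x :
    \big[mine/+oo%E]_(y <- [fset a; b]%fset) ((x - y) ^+ 2)%:E = (q x)%:E.
  rewrite /q -min_sqr_dist EFin_min; apply/eqP; rewrite eq_le; apply/andP; split.
    rewrite le_min; set m := (X in (X <= _)%E).
    have /allP le_m : all (fun y => m <= ((x - y) ^+ 2)%:E)%E [fset a; b]%fset.
      by rewrite -le_big_mine.
    by rewrite !le_m// !inE eqxx ?orbT.
  rewrite le_big_mine; apply/allP => y; rewrite !inE.
  by case/orP => /eqP ->; rewrite ge_min lexx ?orbT.
rewrite /distortion; under eq_integral do rewrite minE.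
rewrite -[LHS]fineK; last first.
  apply: integrable_fin_num => //; apply: (cantor_integrable hP (g := q)).
  exact: continuous_comb.
rewrite -/(Rintegral P setT q) (cantor_Rintegral_comb hP) (cantor_mean hP).
rewrite (cantor_second_moment hP); congr EFin.
by field.
Qed.

(** Completing the square in |b - a| / 2 reduces this to [absdev_bound]. The
    lower bound is kept in the form in which the proof produces it: the variance
    minus the constant of [absdev_bound]. *)
Lemma distortion_pair_ge (a b : R) :
  ((1 / 9 - 256 / 3125)%:E <= distortion P [fset a; b]%fset)%E.
Proof.
rewrite distortion_pair lee_fin.
have := absdev_bound hP ((a + b) / 2).
set y := absdev _; set u := (_ - 1 / 2) ^+ 2.
have -> : ((b - a) / 2) ^+ 2 = (`|b - a| / 2) ^+ 2.
  by rewrite !expr_div_n real_normK ?num_real.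
have := sqr_ge0 (`|b - a| / 2 - y); lra.
Qed.

Lemma distortion_cantor_pair :
  distortion P [fset (9 / 50 : R); 189 / 250]%fset = (1 / 9 - 256 / 3125)%:E.
Proof.
rewrite distortion_pair (_ : (9 / 50 + 189 / 250) / 2 = 117 / 250); last by field.
by rewrite (absdev_midpoint hP) ger0_norm; [congr EFin; field|lra].
Qed.

Lemma two_means_error_value :
  821 / 28125%:R = 1 / 9 - 256 / 3125 :> R.
Proof.
have -> : 28125%N = (9 * 3125)%N by vm_compute.
by rewrite natrM; field.
Qed.

End TwoMeans.

Theorem lemma3p1 (R : realType) (P : probability (measurableTypeR R) R)
    (hP : triadic_cantor P)
    (d : measure_display) (T : measurableType d) (Q : probability T R)
    (X : {RV Q >-> measurableTypeR R}) (hX : has_law X P) :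
  optimal_n_means P 2
    [fset cell_mean X ([:: [:: 1]; [:: 2; 1]])%N;
          cell_mean X ([:: [:: 2; 2]; [:: 2; 3]; [:: 3]])%N]%fset
  /\ quantization_error P 2 = (821 / 28125%:R)%:E.
Proof.
have -> : cell_mean X [:: [:: 1]; [:: 2; 1]]%N = 9 / 50.
  by rewrite (cell_meanE hP hX)// !big_cons !big_nil /= /cantor_map; field.
have -> : cell_mean X [:: [:: 2; 2]; [:: 2; 3]; [:: 3]]%N = 189 / 250.
  by rewrite (cell_meanE hP hX)// !big_cons !big_nil /= /cantor_map; field.
rewrite two_means_error_value.
have V2 : quantization_error P 2 = (1 / 9 - 256 / 3125)%:E.
  apply/eqP; rewrite eq_le; apply/andP; split.
    rewrite -(distortion_cantor_pair hP); apply: ereal_inf_lbound.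
    exists [fset (9 / 50 : R); 189 / 250]%fset => //=.
    by rewrite cardfs2; case: (_ == _).
  apply: le_ereal_inf_tmp => _ [alpha /= /andP[a1 a2] <-].
  have [a [b ->]] : exists a b, alpha = [fset a; b]%fset.
    have /fset0Pn[a aalpha] : alpha != fset0 by rewrite -cardfs_gt0.
    exists a; rewrite -(fsetD1K aalpha).
    move: a2; rewrite (cardfsD1 a) aalpha add1n ltnS leq_eqVlt ltnS leqn0.
    case/orP => [/cardfs1P[b ->]|/eqP/cardfs0_eq ->].
      by exists b.
    by exists a; rewrite fsetU0 fsetUid.
  exact: distortion_pair_ge.
split=> //; split; last by rewrite V2 distortion_cantor_pair.
by rewrite cardfs2; case: (_ == _).
Qed.
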